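(* Let $m\ge2$ be an integer and $0<\alpha<m$. Let $\phi_\alpha(n_1,\dots,n_m)=\langle \Delta x_{n_1}\cdots\Delta x_{n_m}\rangle$ be the $m$-point position auto-correlation function of the Slicer Map with parameter $\alpha$, for integer times $n_1\le n_2\le\cdots\le n_m$. Suppose all times tend to infinity in such a way that, for each $k=2,\dots,m$, the time lag $h_{k-1}=n_k-n_{k-1}$ is either fixed (independent of $n_1$) or satisfies $h_{k-1}\sim n_1^{q}$ for some $q<1$ (possibly depending on $k$). Then $$\phi_\alpha(n_1,n_2,\dots,n_m)\sim\frac{2m}{m-\alpha}\,n_1^{m-\alpha}\qquad\text{as } n_1\to\infty .$$
   Context: Slicer Map. For $\alpha>0$ and $m\in\mathbb Z$ let $\ell_m=(|m|+2^{1/\alpha})^{-\alpha}$. The Slicer Map $S_\alpha:[0,1]\times\mathbb Z\to[0,1]\times\mathbb Z$ is $S_\alpha(x,m)=(x,m-1)$ if $0\le x\le \ell_m$ or $\tfrac12<x\le 1-\ell_m$, and $S_\alpha(x,m)=(x,m+1)$ if $\ell_m<x\le\tfrac12$ or $1-\ell_m<x\le 1$. Start from $(x,0)$, with $x$ uniformly distributed in the right half $(\tfrac12,1]$ of the unit interval (so that motion is in one direction only). Write $(x,m_n)=S_\alpha^n(x,0)$ and let $\Delta x_n=x_n-x_0=m_n$ be the displacement after $n$ iterations. $\langle\cdot\rangle$ is the average over the initial condition: $\langle f\rangle = 2\int_{1/2}^{1} f\,dx$. The symbol $A\sim B$ means $A/B\to1$. *)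

(* Defs.v *)
From HB Require Import structures.
From mathcomp Require Import all_boot all_order all_algebra.
From mathcomp Require Import all_classical all_reals all_analysis.
Set Implicit Arguments.
Unset Strict Implicit.
Unset Printing Implicit Defensive.
Import Order.TTheory GRing.Theory Num.Theory.
Import numFieldNormedType.Exports.
Local Open Scope classical_set_scope.
Local Open Scope ring_scope.

Definition slicer_width (R : realType) (alpha : R) (m : int) : R :=
  (`|m|%:~R + 2 `^ alpha^-1) `^ (- alpha).

(* A map of [0, 1] x Z, extended by the identity to the points (x, m) of
   R x int with x outside [0, 1]; on [0, 1] x Z the last branch is never
   taken, the two conditions being complementary there. *)
Definition slicer (R : realType) (alpha : R) (p : R * int) : R * int :=
  let: (x, m) := p in
  let l := slicer_width alpha m in
  if (0 <= x <= l) || (2^-1 < x <= 1 - l) then (x, m - 1)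
  else if (l < x <= 2^-1) || (1 - l < x <= 1) then (x, m + 1)
  else p.

Definition displacement (R : realType) (alpha : R) (n : nat) (x : R) : int :=
  (iter n (slicer alpha) (x, 0)).2.

Definition average (R : realType) (f : R -> R) : R :=
  2 * (\int[lebesgue_measure]_(x in `]2^-1, 1]) f x)%R.

(* The times are t 1, ..., t m; the other values of t are irrelevant. *)
Definition autocorrelation (R : realType) (alpha : R) (m : nat)
    (t : nat -> nat) : R :=
  average (fun x => \prod_(1 <= k < m.+1) (displacement alpha (t k) x)%:~R).

Definition asymp_equiv (R : realType) (u v : nat -> R) : Prop :=
  (fun j => u j / v j) @ \oo --> (1 : R).

(* Main.v *)
Require Import Defs.
From mathcomp Require Import all_boot all_order all_algebra.
From mathcomp Require Import all_classical all_reals all_analysis.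
From mathcomp Require Import zify ring lra.
Set Implicit Arguments.
Unset Strict Implicit.
Unset Printing Implicit Defensive.
Import Order.TTheory GRing.Theory Num.Theory.
Import numFieldNormedType.Exports.
Local Open Scope classical_set_scope.
Local Open Scope ring_scope.

(** For [1/2 < x <= 1] the orbit of [(x, 0)] moves right until the first site
    [K] with [x <= 1 - l_K], and then alternates between [K] and [K - 1]. Hence
    every displacement at time [t] is [min t K] or [min t K - 1], and for sorted
    times the correlation lies between the averages of [(min n_1 K - 1)^m] and
    [min n_m K ^ m]. Since [K > k] has probability [2 l_k], summation by parts
    gives [< F (min n K) > = F 0 + 2 \sum_(k < n) (F (k+1) - F k) l_k]. By the
    Stolz-Cesaro theorem [\sum_(k < n) ((k+1)^m - k^m) (k + c)^-alpha] is
    equivalent to [m / (m - alpha) n^(m - alpha)] for every [c >= 0], and the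
    hypothesis on the lags gives [n_m ~ n_1], so both bounds have the announced
    equivalent. *)

(** * Orbits of points starting in the right half *)

Definition crosses {R : realType} (alpha x : R) (k : nat) : bool :=
  1 - slicer_width alpha k%:Z < x.

(* The index [min n K] of the header, as a count of the sites crossed so far. *)
Definition farthest {R : realType} (alpha : R) (n : nat) (x : R) : nat :=
  (\sum_(k < n) crosses alpha x k)%N.

#[local] Arguments slicer : simpl never.
#[local] Arguments slicer_width : simpl never.

Section Dynamics.
Variables (R : realType) (alpha : R).
Hypothesis alpha_gt0 : 0 < alpha.

Lemma slicer_width_nat k :
  slicer_width alpha k%:Z = (k%:R + 2 `^ alpha^-1) `^ (- alpha).
Proof. by []. Qed.

Lemma slicer_width0 : slicer_width alpha 0 = 2^-1.
Proof.
rewrite (slicer_width_nat 0) add0r -powRrM mulrN mulVf ?lt0r_neq0//.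
by rewrite powR_inv1.
Qed.

Lemma slicer_width_gt0 m : 0 < slicer_width alpha m.
Proof. by rewrite powR_gt0// ltr_wpDl// powR_gt0. Qed.

Lemma slicer_width_anti (j k : nat) :
  (j <= k)%N -> slicer_width alpha k%:Z <= slicer_width alpha j%:Z.
Proof.
move=> jk; rewrite !slicer_width_nat !powRN lef_pV2 ?posrE ?powR_gt0//;
  try by rewrite ltr_wpDl// powR_gt0.
apply: (ge0_ler_powR (ltW alpha_gt0)).
- by rewrite nnegrE addr_ge0 ?powR_ge0.
- by rewrite nnegrE addr_ge0 ?powR_ge0.
- by rewrite lerD2r ler_nat.
Qed.

Lemma slicer_width_le_half (k : nat) : slicer_width alpha k%:Z <= 2^-1.
Proof. by rewrite -slicer_width0 (slicer_width_anti (leq0n k)). Qed.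

Lemma crosses_anti x (j k : nat) :
  (j <= k)%N -> crosses alpha x k -> crosses alpha x j.
Proof.
move=> jk; apply: le_lt_trans.
by rewrite lerB// slicer_width_anti.
Qed.

Lemma farthestS n x :
  farthest alpha n.+1 x = (farthest alpha n x + crosses alpha x n)%N.
Proof. by rewrite /farthest big_ord_recr. Qed.

(** The widths decrease with the site, so crossing site [n] entails crossing every earlier one and
    all terms of the sum are 1. *)
Lemma farthest_crosses n x : crosses alpha x n -> farthest alpha n x = n.
Proof.
move=> cn; rewrite /farthest (eq_bigr (fun=> 1%N)) ?sum1_card ?card_ord//.
by move=> i _; rewrite (crosses_anti (ltnW (ltn_ord i)) cn).
Qed.

Lemma farthest_leq n x : (farthest alpha n x <= n)%N.
Proof.
elim: n => [|n IH]; first by rewrite /farthest big_ord0.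
by rewrite farthestS; case: crosses; lia.
Qed.

(** The crossed sites form an initial segment, so counting those below [n] amounts to finding where
    the segment ends. *)
Lemma ltn_farthest n x k :
  (k < farthest alpha n x)%N = (k < n)%N && crosses alpha x k.
Proof.
elim: n => [|n IH]; first by rewrite /farthest big_ord0.
rewrite farthestS; case: (boolP (crosses alpha x n)) => cn.
  rewrite farthest_crosses// addn1; case: ltnP => //= kn.
  by rewrite (crosses_anti _ cn).
rewrite addn0 IH ltnS [in RHS]leq_eqVlt; case: eqVneq => [->|//].
by rewrite ltnn (negbTE cn).
Qed.

(** Both sides exceed the same numbers [k]. This makes the positions at all times functions of the
    single count at the last time. *)
Lemma farthest_minn n N x :
  (n <= N)%N -> farthest alpha n x = minn n (farthest alpha N x).
Proof.
move=> nN; have key k : (k < farthest alpha n x)%N = (k < minn n (farthest alpha N x))%N.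
  rewrite leq_min !ltn_farthest; case: ltnP => //= kn.
  by rewrite (leq_trans kn nN).
have := key (farthest alpha n x); have := key (minn n (farthest alpha N x)).
by lia.
Qed.

(** Once the first uncrossed site is reached, the orbit steps back and forth; the parity of the time
    elapsed since then tells on which of the two sites it is. *)
Lemma iter_slicer n x : 2^-1 < x <= 1 ->
  iter n (slicer alpha) (x, 0) =
  (x, (farthest alpha n x)%:Z - (odd (n - farthest alpha n x))%:Z).
Proof.
case/andP=> x_gt x_le.
have c0 : crosses alpha x 0 by rewrite /crosses slicer_width0; lra.
(* As [l <= 1/2 < x], only the branches comparing [x] with [1 - l] can apply. *)
have step (k : nat) : slicer alpha (x, k%:Z) =
    (x, k%:Z + (if crosses alpha x k then 1 else - 1)).
  rewrite /slicer /crosses.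
  have := slicer_width_le_half k; set l := slicer_width _ _ => l_le.
  have -> : (0 <= x <= l) = false by apply/negbTE/negP; lra.
  have -> : (l < x <= 2^-1) = false by apply/negbTE/negP; lra.
  by rewrite x_gt x_le andbT/=; case: ltP.
elim: n => [|n IH]; first by rewrite /farthest big_ord0.
rewrite iterS IH farthestS.
(* These two instances say that the site [T] reached is not crossed if [T < n], and that the site
   before it is. *)
have := ltn_farthest n x (farthest alpha n x); rewrite ltnn.
have := ltn_farthest n x (farthest alpha n x).-1.
have := farthest_leq n x.
case: (boolP (crosses alpha x n)) => cn.
  rewrite farthest_crosses// subnn/= subr0 step cn => _ _ _.
  by rewrite addn1 subnn/= subr0 -PoszD addn1.
rewrite addn0; set T := farthest alpha n x => Tn HT1 HT.
have T0 : (0 < n)%N -> (0 < T)%N by rewrite ltn_farthest c0 => ->.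
have n0 : (0 < n)%N by case: (n) cn; rewrite // c0.
have {}T0 := T0 n0.
have cT : crosses alpha x T = false.
  case: (ltnP T n) HT => //= nT _; apply/negbTE.
  by have -> : T = n by lia.
(* Even parity: the orbit is at [T], which is not crossed, and steps back. Odd parity: it is at
   [T - 1], which is crossed, and returns to [T]. *)
rewrite subSn//=; case: (odd (n - T)) => /=; last first.
  by rewrite subr0 step cT.
have -> : T%:Z - 1 = T.-1%:Z by lia.
rewrite step; move: HT1; rewrite (_ : (T.-1 < T)%N); last by lia.
by move=> /esym/andP[_ ->]; congr (_, _); lia.
Qed.

(** The indicators keep exactly the increments of [F] below the count. The result is linear in them,
    so it can be integrated term by term. *)
Lemma telescope_farthest (F : nat -> R) n x :
  F (farthest alpha n x) =
  F 0%N + \sum_(k < n) (F k.+1 - F k) * (crosses alpha x k)%:R.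
Proof.
elim: n => [|n IH]; first by rewrite /farthest !big_ord0 addr0.
rewrite big_ord_recr/= addrA -IH farthestS.
case: (boolP (crosses _ _ _)) => cn; last by rewrite addn0 mulr0 addr0.
by rewrite farthest_crosses// addn1 mulr1 subrKC.
Qed.

(** * Averages of functions of the number of crossed sites *)

Local Notation mu := (@lebesgue_measure R).
Local Notation D := (`]2^-1, 1]%classic : set R).

Let mD : measurable D.
Proof. exact: measurable_itv. Qed.

Lemma half_measure : mu D = (2^-1)%:E.
Proof.
rewrite lebesgue_measure_itv/= lte_fin ifT; last by lra.
by rewrite -EFinD; congr EFin; lra.
Qed.

Lemma integrable_half_cst (c : R) : mu.-integrable D (EFin \o (fun=> c)).
Proof.
apply: measurable_bounded_integrable => //.
- by have : (mu D < +oo)%E by rewrite half_measure ltry.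
- by exists `|c|; split; [exact: num_real|move=> r /ltW ? t _].
Qed.

Lemma crosses_indic k x : x \in D ->
  (crosses alpha x k)%:R = \1_(`]1 - slicer_width alpha k%:Z, 1] : set R) x :> R.
Proof.
move=> /set_mem ; rewrite /= in_itv/= => /andP[_ x1].
by rewrite indicE mem_setE /= in_itv/= x1 andbT.
Qed.

Lemma integrable_crosses k :
  mu.-integrable D (EFin \o (fun x => (crosses alpha x k)%:R)).
Proof.
have indic_int : mu.-integrable D (EFin \o \1_(`]1 - slicer_width alpha k%:Z, 1] : set R)).
  apply: (integrableS measurableT) => //.
  exact: integrable_indic_itv.
apply: eq_integrable indic_int => //.
by move=> x xD /=; rewrite crosses_indic.
Qed.

Lemma Rintegral_crosses k :
  \int[mu]_(x in D) (crosses alpha x k)%:R = slicer_width alpha k%:Z.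
Proof.
transitivity (\int[mu]_(x in D) (\1_(`]1 - slicer_width alpha k%:Z, 1] : set R) x)).
  by apply: eq_Rintegral => x; exact: crosses_indic.
rewrite /Rintegral integral_indic//.
(* The interval lies inside the right half because [l_k <= 1/2]. *)
rewrite setIidl; last first.
  move=> x /=; rewrite /= !in_itv/=.
  by have := slicer_width_le_half k; lra.
apply: (congr1 fine (_ : mu `]1 - slicer_width alpha k%:Z, 1] = _%:E)).
rewrite lebesgue_measure_itv/= lte_fin ifT.
  by rewrite -EFinD opprB subrKC.
by rewrite ltrBlDr ltrDl slicer_width_gt0.
Qed.

Lemma integrable_farthest (F : nat -> R) n :
  mu.-integrable D (EFin \o (fun x => F (farthest alpha n x))).
Proof.
elim: n => [|n IH].
  apply: eq_integrable (integrable_half_cst (F 0%N)) => //.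
  by move=> x _; rewrite /= /farthest big_ord0.
have intS : mu.-integrable D ((EFin \o (fun x => F (farthest alpha n x))) \+
   (fun x => (F n.+1 - F n)%:E * (EFin \o (fun x => (crosses alpha x n)%:R)) x))%E.
  by apply: integrableD => //; apply: integrableZl => //; exact: integrable_crosses.
apply: eq_integrable intS => //.
move=> x _ /=; rewrite -EFinM -EFinD [in RHS]telescope_farthest.
by rewrite telescope_farthest big_ord_recr/= addrA.
Qed.

Lemma average_farthest (F : nat -> R) n :
  average (fun x => F (farthest alpha n x)) =
  F 0%N + 2 * \sum_(k < n) (F k.+1 - F k) * slicer_width alpha k%:Z.
Proof.
rewrite /average; elim: n => [|n IH].
  rewrite big_ord0; transitivity (2 * \int[mu]_(x in D) F 0%N).
    by congr (_ * _); apply: eq_Rintegral => x _; rewrite /farthest big_ord0.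
  rewrite Rintegral_cst// mulr0 addr0.
  transitivity (2 * (F 0%N * 2^-1)); last by rewrite mulrCA mulfV ?mulr1.
  by do 2!congr (_ * _); exact: (congr1 fine half_measure).
rewrite big_ord_recr/= [2 * (_ + _)]mulrDr addrA -IH.
transitivity (2 * \int[mu]_(x in D) (F (farthest alpha n x) +
    (F n.+1 - F n) * (crosses alpha x n)%:R)).
  congr (_ * _); apply: eq_Rintegral => x _.
  by rewrite [in LHS]telescope_farthest telescope_farthest big_ord_recr/= addrA.
rewrite RintegralD//.
- rewrite RintegralZl//; last exact: integrable_crosses.
  by rewrite Rintegral_crosses; ring.
- exact: integrable_farthest.
- have intM : mu.-integrable D (fun x =>
      (F n.+1 - F n)%:E * (EFin \o (fun x => (crosses alpha x n)%:R)) x)%E.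
    by apply: integrableZl => //; exact: integrable_crosses.
  exact: intM.
Qed.

(** Since [l_0 = 1/2], site 0 is crossed throughout the right half, so the count is positive when
    [n > 0]. This excludes the value 0, where the formula for the position can give -1. *)
Lemma le_average_farthest (F G : nat -> R) n :
  (forall k, (0 < k <= n)%N -> F k <= G k) -> (0 < n)%N ->
  average (fun x => F (farthest alpha n x)) <=
  average (fun x => G (farthest alpha n x)).
Proof.
move=> FG n0; rewrite /average ler_pM2l//.
apply: le_Rintegral => //; [exact: integrable_farthest..|move=> x].
rewrite /= in_itv/= => /andP[x_gt _]; apply: FG.
rewrite farthest_leq ltn_farthest n0 /crosses slicer_width0 andbT/=.
by lra.
Qed.
End Dynamics.

(** * The Stolz-Cesaro theorem and limits of real powers *)

Section Asymptotics.
Variable R : realType.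

(** Past some [M], each increment of [l v - u] is at most [e / 2] times that of [v]. Summing bounds
    [l v n - u n] by [e / 2 * v n] plus a constant, and the growth of [v] absorbs the constant into
    another [e / 2 * v n]. *)
Lemma stolz_cesaro (u v : nat -> R) (l : R) :
  (forall k, v k < v k.+1) -> v @ \oo --> +oo ->
  (fun k => (u k.+1 - u k) / (v k.+1 - v k)) @ \oo --> l ->
  (fun k => u k / v k) @ \oo --> l.
Proof.
move=> v_incr v_infty uv_l; apply/cvgrPdist_le => e e0.
have e2 : 0 < e / 2 by rewrite divr_gt0.
have [M _ M_close] : \forall k \near \oo,
    `|l - (u k.+1 - u k) / (v k.+1 - v k)| <= e / 2 /\ 0 < v k.
  near=> k; split; near: k; first by move/cvgrPdist_le : uv_l; apply.
  by move/cvgryPgt : v_infty; apply.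
have bound n : (M <= n)%N ->
    `|l * (v n - v M) - (u n - u M)| <= e / 2 * (v n - v M).
  elim: n => [|n IH]; first by rewrite leqn0 => /eqP ->; rewrite !subrr !mulr0 subrr normr0.
  rewrite leq_eqVlt => /predU1P[<-|]; first by rewrite !subrr !mulr0 subrr normr0.
  rewrite ltnS => Mn; have [close _] := M_close n Mn.
  have dv : 0 < v n.+1 - v n by rewrite subr_gt0.
  have -> : l * (v n.+1 - v M) - (u n.+1 - u M) =
      (l * (v n - v M) - (u n - u M)) +
      (l - (u n.+1 - u n) / (v n.+1 - v n)) * (v n.+1 - v n).
    by rewrite mulrBl divfK ?gt_eqF//; ring.
  rewrite (le_trans (ler_normD _ _))// normrM [`|v _ - v _|]gtr0_norm//.
  have -> : e / 2 * (v n.+1 - v M) =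
      e / 2 * (v n - v M) + e / 2 * (v n.+1 - v n) by ring.
  by apply: lerD; [exact: IH|rewrite ler_wpM2r// ltW].
have [_ vM] := M_close M (leqnn M).
near=> n.
have Mn : (M <= n)%N by near: n; exact: nbhs_infty_ge.
have [_ vn] := M_close n Mn.
have big : `|l * v M - u M| / (e / 2) <= v n.
  by near: n; move/cvgryPge : v_infty; apply.
rewrite ler_pdivrMr// in big.
have -> : l - u n / v n = (l * v n - u n) / v n by rewrite mulrBl mulfK ?gt_eqF.
rewrite normrM normfV [`|v n|]gtr0_norm// ler_pdivrMr//.
have -> : l * v n - u n = (l * (v n - v M) - (u n - u M)) + (l * v M - u M) by ring.
rewrite (le_trans (ler_normD _ _))//.
apply: (le_trans (lerD (bound n Mn) big)).
have : 0 <= e / 2 * v M by rewrite mulr_ge0 ?ltW.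
nra.
Unshelve. all: by end_near. Qed.

Lemma cvg_powR1 {T : Type} {F : set_system T} {FF : Filter F} (f : T -> R) (q : R) :
  f @ F --> (1 : R) -> (fun x => f x `^ q) @ F --> (1 : R).
Proof.
move=> f1.
have cont : {for (1 : R), continuous (fun x : R => x `^ q)}.
  apply: differentiable_continuous; apply/derivable1_diffP.
  by case: (is_derive1_powR q (@ltr01 R)).
have one q' : (1 : R) `^ q' = 1 by rewrite powR1.
rewrite -[X in _ --> X](one q).
by apply: (cvg_comp f (fun x => x `^ q) f1); exact: cont.
Qed.

Lemma powRV (x p : R) : 0 <= x -> x^-1 `^ p = (x `^ p)^-1.
Proof. by move=> x0; rewrite -powR_inv1// -powRrM mulN1r powRN. Qed.

Lemma cvg_powR_infty (p : R) : 0 < p -> (fun k : nat => k%:R `^ p : R) @ \oo --> +oo.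
Proof.
move=> p0; apply/cvgryPge => A; near=> k.
have Ak : `|A| `^ p^-1 <= k%:R.
  by near: k; move/cvgryPge : (@cvgr_idn R); apply.
apply: (le_trans (ler_norm A)).
have -> : `|A| = (`|A| `^ p^-1) `^ p.
  by rewrite -powRrM mulVf ?lt0r_neq0// powRr1.
by apply: (ge0_ler_powR (ltW p0)); rewrite ?nnegrE ?powR_ge0 ?ler0n.
Unshelve. all: by end_near. Qed.

(** Factoring out [k ^ p] leaves the difference quotient of [x ^ p] at 1 with step [1 / k], whose
    limit is the derivative [p]. *)
Lemma cvg_powR_increment (p : R) :
  (fun k : nat => (k.+1%:R `^ p - k%:R `^ p) / k%:R `^ (p - 1) : R) @ \oo --> p.
Proof.
(* The shift avoids [k = 0] and matches the step [1 / (k + 1)] of [harmonic]. *)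
rewrite -cvg_shiftS.
have [der val] := is_derive1_powR p (@ltr01 R).
have one q : (1 : R) `^ q = 1 by rewrite powR1.
have slope : h^-1 *: (((fun x : R => x `^ p) \o shift 1) (h *: 1) - 1 `^ p) @[h --> 0^'] --> p.
  by rewrite -[X in _ --> X]mulr1 -[X in _ * X](one (p - 1)) -val; exact: der.
have /cvgr_dnbhsP/(_ (@harmonic R)) := slope.
move=> /(_ (conj (fun n => lt0r_neq0 (harmonic_gt0 n)) (@cvg_harmonic R))).
apply: cvg_trans; apply: near_eq_cvg; near=> k.
rewrite /= /harmonic/= invrK powR1.
have k0 : (0 : R) < k.+1%:R by [].
have -> : k.+1%:R `^ (p - 1) = k.+1%:R `^ p / k.+1%:R :> R.
  by rewrite powRB ?powRr1//; apply/implyP => _; rewrite gt_eqF.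
have -> : k.+2%:R = k.+1%:R * (k.+1%:R^-1 *: 1 + 1) :> R.
  rewrite scaler1 mulrDr mulfV ?gt_eqF// mulr1.
  by rewrite -[k.+2]addn1 natrD addrC.
rewrite powRM ?addr_ge0//; last by rewrite scaler1 invr_ge0.
have : k.+1%:R `^ p != 0 :> R by rewrite gt_eqF ?powR_gt0.
rewrite /GRing.scale/=; move: (_ `^ p) (_ `^ p) => a b a0.
by field; rewrite gt_eqF// a0.
Unshelve. all: by end_near. Qed.

(** * Growth of the power sums along the times *)

Definition power_sum (m : nat) (alpha c : R) (n : nat) : R :=
  \sum_(k < n) (k.+1%:R ^+ m - k%:R ^+ m) * (k%:R + c) `^ (- alpha).

Lemma cvg_power_sum (m : nat) (alpha c : R) : 0 <= c -> alpha < m%:R ->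
  (fun n => power_sum m alpha c n / n%:R `^ (m%:R - alpha)) @ \oo -->
  m%:R / (m%:R - alpha).
Proof.
move=> c0 alpha_m; set p := m%:R - alpha.
have p0 : 0 < p by rewrite subr_gt0.
apply: (@stolz_cesaro _ (fun n : nat => n%:R `^ p)).
- move=> k; apply: (gt0_ltr_powR p0); rewrite ?nnegrE ?ler0n//.
  by rewrite ltr_nat.
- exact: cvg_powR_infty.
have shift_c : (fun k : nat => (k%:R + c) / k%:R : R) @ \oo --> (1 : R).
  have : (fun k : nat => 1 + c * (k%:R)^-1 : R) @ \oo --> (1 + c * 0 : R).
    apply: cvgD; first exact: cvg_cst.
    apply: cvgM; first exact: cvg_cst.
    apply/gtr0_cvgV0; last exact: cvgr_idn.
    by near=> k; rewrite ltr0n; near: k; exact: nbhs_infty_gt.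
  rewrite mulr0 addr0; apply: cvg_trans; apply: near_eq_cvg; near=> k.
  have k0 : (0 < k)%N by near: k; exact: nbhs_infty_gt.
  by rewrite mulrDl mulfV// pnatr_eq0 -lt0n.
(* The quotient of increments required by [stolz_cesaro], split into three normalized factors: the
   increment of [k ^ m], the width, and the inverse increment of [k ^ p]. The powers of [k] cancel
   because [p - 1 = (m - 1) - alpha]. *)
have limit : (fun k : nat => (k.+1%:R `^ m%:R - k%:R `^ m%:R) / k%:R `^ (m%:R - 1) *
    ((k%:R + c) / k%:R) `^ (- alpha) *
    ((k.+1%:R `^ p - k%:R `^ p) / k%:R `^ (p - 1))^-1 : R) @ \oo --> m%:R * 1 / p.
  apply: cvgM; last by apply: cvgV; [rewrite gt_eqF|exact: cvg_powR_increment].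
  by apply: cvgM; [exact: cvg_powR_increment|exact: cvg_powR1].
rewrite mulr1 in limit.
move: limit; apply: cvg_trans; apply: near_eq_cvg; near=> k.
have k0 : (0 < k)%N by near: k; exact: nbhs_infty_gt.
have kR : (0 : R) < k%:R by rewrite ltr0n.
have -> : power_sum m alpha c k.+1 - power_sum m alpha c k =
    (k.+1%:R ^+ m - k%:R ^+ m) * (k%:R + c) `^ (- alpha).
  by rewrite /power_sum big_ord_recr/= addrAC subrr add0r.
rewrite !powR_mulrn//.
rewrite [((_ + c) / _) `^ _]powRM ?addr_ge0 ?invr_ge0 ?ler0n// powRV ?ler0n// [k%:R `^ - _]powRN invrK.
have -> : k%:R `^ (p - 1) = k%:R `^ (m%:R - 1) / k%:R `^ alpha :> R.
  by rewrite -powRB; [congr (_ `^ _); rewrite /p; ring|apply/implyP => _; rewrite gt_eqF].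
have : k%:R `^ (m%:R - 1) != 0 :> R by rewrite gt_eqF ?powR_gt0.
have : k%:R `^ alpha != 0 :> R by rewrite gt_eqF ?powR_gt0.
have : k.+1%:R `^ p - k%:R `^ p != 0 :> R.
  rewrite subr_eq0 gt_eqF//; apply: (gt0_ltr_powR p0); rewrite ?nnegrE ?ler0n//.
  by rewrite ltr_nat.
move: (_ - _ : R) (_ `^ alpha) (_ `^ (_ - 1)) => x y z x0 y0 z0.
by field; rewrite x0 y0 z0.
Unshelve. all: by end_near. Qed.

(** Changing the reference time from [u] to [v] costs a factor [(u / v) ^ (m - alpha)], which tends
    to 1. *)
Lemma cvg_power_sum_times (m : nat) (alpha c : R) (u v : nat -> nat) :
  0 <= c -> alpha < m%:R -> u @ \oo --> \oo -> v @ \oo --> \oo ->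
  (fun j => (u j)%:R / (v j)%:R : R) @ \oo --> (1 : R) ->
  (fun j => power_sum m alpha c (u j) / (v j)%:R `^ (m%:R - alpha)) @ \oo -->
  m%:R / (m%:R - alpha).
Proof.
move=> c0 alpha_m u_infty v_infty uv1.
have : (fun j => power_sum m alpha c (u j) / (u j)%:R `^ (m%:R - alpha) *
    ((u j)%:R / (v j)%:R) `^ (m%:R - alpha)) @ \oo --> m%:R / (m%:R - alpha) * 1.
  apply: cvgM; last exact: cvg_powR1.
  exact: (cvg_comp _ _ u_infty (cvg_power_sum c0 alpha_m)).
rewrite mulr1; apply: cvg_trans; apply: near_eq_cvg; near=> j.
have uj : (0 < u j)%N by near: j; move/cvgnyPgt : u_infty; apply.
have vj : (0 < v j)%N by near: j; move/cvgnyPgt : v_infty; apply.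
rewrite /= powRM ?invr_ge0 ?ler0n//.
rewrite powRV ?ler0n//.
have : (u j)%:R `^ (m%:R - alpha) != 0 :> R by rewrite gt_eqF ?powR_gt0 ?ltr0n.
by move=> u0; rewrite mulrA divfK.
Unshelve. all: by end_near. Qed.

(** In the second case [h / v] is [h / v ^ q], which tends to 1, times [v ^ (q - 1)], which tends to
    0 as [q < 1]. *)
Lemma cvg_lag_ratio (h v : nat -> nat) : v @ \oo --> \oo ->
  (exists h0, forall j, h j = h0) \/
  (exists2 q : R, q < 1 &
     asymp_equiv (fun j => (h j)%:R) (fun j => (v j)%:R `^ q)) ->
  (fun j => (h j)%:R / (v j)%:R : R) @ \oo --> (0 : R).
Proof.
move=> v_infty.
have inv_pow (p : R) : 0 < p -> (fun j => ((v j)%:R `^ p)^-1 : R) @ \oo --> (0 : R).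
  move=> p0; apply/gtr0_cvgV0; last exact: (cvg_comp _ _ v_infty (cvg_powR_infty p0)).
  near=> j; rewrite powR_gt0// ltr0n.
  by near: j; move/cvgnyPgt : v_infty; apply.
case=> [[h0 hE]|[q q1 hq]].
  have : (fun j => h0%:R * ((v j)%:R `^ 1)^-1 : R) @ \oo --> (h0%:R * 0 : R).
    by apply: cvgM; [exact: cvg_cst|exact: inv_pow].
  rewrite mulr0; apply: cvg_trans; apply: near_eq_cvg; near=> j.
  by rewrite /= hE powRr1.
have q1' : 0 < 1 - q by rewrite subr_gt0.
have : (fun j => (h j)%:R / (v j)%:R `^ q * ((v j)%:R `^ (1 - q))^-1 : R) @ \oo -->
    (1 * 0 : R) by apply: cvgM => //; exact: inv_pow.
rewrite mulr0; apply: cvg_trans; apply: near_eq_cvg; near=> j.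
have vj : (0 : R) < (v j)%:R.
  by rewrite ltr0n; near: j; move/cvgnyPgt : v_infty; apply.
rewrite /= -mulrA -invfM -powRD; last by apply/implyP => _; rewrite gt_eqF.
by rewrite subrKC powRr1// ltW.
Unshelve. all: by end_near. Qed.

End Asymptotics.

(** * Bounds on the correlation and passage to the limit *)

Lemma times_nondecreasing (n : nat -> nat) (m : nat) :
  (forall k, (2 <= k <= m)%N -> (n k.-1 <= n k)%N) ->
  forall i k, (1 <= i <= k)%N -> (k <= m)%N -> (n i <= n k)%N.
Proof.
move=> n_sorted i k /andP[i1]; elim: k => [|k IH]; first by lia.
rewrite leq_eqVlt => /predU1P[->//|ik km].
apply: (leq_trans (IH ik (ltnW km))).
by apply: (n_sorted k.+1); lia.
Qed.

Lemma power_sum_average (R : realType) (alpha : R) (m n : nat) :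
  0 < alpha -> (0 < m)%N ->
  average (fun x => (farthest alpha n x)%:R ^+ m) =
  2 * power_sum m alpha (2 `^ alpha^-1) n.
Proof.
move=> alpha_gt0 m0.
by rewrite (average_farthest alpha_gt0 (fun k => k%:R ^+ m)) expr0n eqn0Ngt m0 add0r.
Qed.

Lemma power_sum_average_pred (R : realType) (alpha : R) (m n : nat) :
  0 < alpha -> (0 < m)%N -> (0 < n)%N ->
  average (fun x => (farthest alpha n x).-1%:R ^+ m) =
  2 * power_sum m alpha (1 + 2 `^ alpha^-1) n.-1.
Proof.
move=> alpha_gt0 m0; case: n => // n _.
rewrite (average_farthest alpha_gt0 (fun k => k.-1%:R ^+ m)) expr0n eqn0Ngt m0 add0r.
(* The term [k = 0] vanishes, as 0 and 1 have the same truncated predecessor; reindexing the others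
   moves each width one site on. *)
rewrite big_ord_recl/= subrr mul0r add0r; congr (_ * _).
by apply: eq_bigr => k _; rewrite slicer_width_nat /bump/= add1n addrA natr1.
Qed.

Lemma average_eq (R : realType) (f g : R -> R) :
  (forall x, 2^-1 < x <= 1 -> f x = g x) -> average f = average g.
Proof.
move=> fg; congr (_ * _); apply: eq_Rintegral => x /set_mem.
by rewrite /= in_itv => /fg.
Qed.

(* The shift by 1 in the lower bound turns [l_(k+1)] into the constant [1 + c]. *)
Lemma autocorrelation_bounds (R : realType) (alpha : R) (m : nat) (n : nat -> nat) :
  0 < alpha -> (0 < m)%N -> (0 < n 1%N)%N ->
  (forall k, (2 <= k <= m)%N -> (n k.-1 <= n k)%N) ->
  2 * power_sum m alpha (1 + 2 `^ alpha^-1) (n 1%N).-1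
    <= autocorrelation alpha m n <= 2 * power_sum m alpha (2 `^ alpha^-1) (n m).
Proof.
move=> alpha_gt0 m0 n1 n_sorted.
have mono := times_nondecreasing n_sorted.
have n1m : (n 1 <= n m)%N by apply: mono.
(* The displacement at time [t] when the final count is [k], so that [G] expresses the whole product
   through that count. *)
pose position t k : int := (minn t k)%:Z - (odd (t - minn t k))%:Z.
pose G k : R := \prod_(1 <= i < m.+1) (position (n i) k)%:~R.
have -> : autocorrelation alpha m n = average (fun x => G (farthest alpha (n m) x)).
  apply: average_eq => x x01; rewrite /G !big_nat; apply: eq_bigr => i /andP[i1 im].
  rewrite /displacement iter_slicer//= (farthest_minn alpha_gt0 (N := n m))//.
  by apply: mono; rewrite ?i1.
have expn_prod (y : R) : y ^+ m = \prod_(1 <= i < m.+1) y.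
  by rewrite prodr_const_nat subn1.
apply/andP; split.
  rewrite -power_sum_average_pred//.
  have -> : average (fun x => (farthest alpha (n 1%N) x).-1%:R ^+ m) =
      average (fun x => (minn (n 1%N) (farthest alpha (n m) x)).-1%:R ^+ m).
    by apply: average_eq => x _; rewrite (farthest_minn alpha_gt0 _ n1m).
  apply: (le_average_farthest alpha_gt0 (F := fun k => (minn (n 1%N) k).-1%:R ^+ m) (G := G));
    last exact: leq_trans n1m.
  move=> k /andP[k0 kn].
  rewrite expn_prod /G !big_nat; apply: ler_prod => i /andP[i1 im].
  have n1i : (n 1 <= n i)%N by apply: mono; lia.
  (* Both [n 1] and [k] are positive, so the truncated predecessor is a true one; it is also
     nonnegative, as comparing products factor by factor requires. *)
  have low : (minn (n 1%N) k).-1%:Z <= position (n i) k by rewrite /position; lia.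
  by rewrite ler0n/=; move: low; rewrite -(ler_int R).
rewrite -power_sum_average//.
apply: (le_average_farthest alpha_gt0 (F := G) (G := fun k => k%:R ^+ m));
  last exact: leq_trans n1m.
move=> k /andP[k0 kn].
rewrite expn_prod /G !big_nat; apply: ler_prod => i /andP[i1 im].
have n1i : (n 1 <= n i)%N by apply: mono; lia.
have pos : 0 <= position (n i) k by rewrite /position; lia.
have : position (n i) k <= k%:Z by rewrite /position; lia.
by rewrite ler0z pos -(ler_int R).
Qed.

Unset Implicit Arguments.

(* n j k is the k-th time n_k (1 <= k <= m) at stage j of the limit. *)
Theorem lemma2 (R : realType) (m : nat) (alpha : R) (n : nat -> nat -> nat)
    (m_ge2 : (2 <= m)%N) (alpha_gt0 : 0 < alpha) (alpha_lt_m : alpha < m%:R)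
    (n_sorted : forall j k, (2 <= k <= m)%N -> (n j k.-1 <= n j k)%N)
    (n_infty : forall k, (1 <= k <= m)%N -> (fun j => n j k) @ \oo --> \oo)
    (n_lag : forall k, (2 <= k <= m)%N ->
       (exists h : nat, forall j, (n j k - n j k.-1)%N = h) \/
       (exists2 q : R, q < 1 &
          asymp_equiv (fun j => (n j k - n j k.-1)%:R)
                      (fun j => (n j 1%N)%:R `^ q))) :
  asymp_equiv (fun j => autocorrelation alpha m (n j))
    (fun j => 2 * m%:R / (m%:R - alpha) * (n j 1%N)%:R `^ (m%:R - alpha)).
Proof.
have m0 : (0 < m)%N by exact: ltnW.
have n1_infty := n_infty 1%N m0.
have ratio k : (1 <= k <= m)%N ->
    (fun j => (n j k)%:R / (n j 1%N)%:R : R) @ \oo --> (1 : R).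
  elim: k => // -[_ _|k IH km].
    have : (fun _ : nat => 1 : R) @ \oo --> (1 : R) by exact: cvg_cst.
    apply: cvg_trans; apply: near_eq_cvg; near=> j.
    rewrite mulfV// pnatr_eq0 -lt0n.
    by near: j; move/cvgnyPgt : n1_infty; apply.
  (* Each time is the previous one plus its lag, and every lag is negligible against the first
     time. *)
  have : (fun j => (n j k.+1)%:R / (n j 1%N)%:R +
      (n j k.+2 - n j k.+1)%:R / (n j 1%N)%:R : R) @ \oo --> (1 + 0 : R).
    apply: cvgD; first by apply: IH; lia.
    by apply: cvg_lag_ratio => //; exact: n_lag.
  rewrite addr0; apply: cvg_trans; apply: near_eq_cvg; near=> j.
  by rewrite -mulrDl -natrD subnKC//; apply: (n_sorted j k.+2).
have ratio_pred : (fun j => (n j 1%N).-1%:R / (n j 1%N)%:R : R) @ \oo --> (1 : R).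
  have : (fun j => 1 - 1%:R / (n j 1%N)%:R : R) @ \oo --> (1 - 0 : R).
    apply: cvgB; first exact: cvg_cst.
    (* A constant lag of 1 yields that the inverse of the first time tends to 0. *)
    by apply: (@cvg_lag_ratio R (fun=> 1%N)) => //; left; exists 1%N.
  rewrite subr0; apply: cvg_trans; apply: near_eq_cvg; near=> j.
  have n1 : (0 < n j 1%N)%N by near: j; move/cvgnyPgt : n1_infty; apply.
  have nE : (n j 1%N)%:R = (n j 1%N).-1%:R + 1 :> R by rewrite natr1 prednK.
  have nz : (n j 1%N)%:R != 0 :> R by rewrite pnatr_eq0 -lt0n.
  by apply: (mulIf nz); rewrite mulrBl !divfK// mul1r nE addrK.
have pred_infty : (fun j => (n j 1%N).-1) @ \oo --> \oo.
  apply/cvgnyPge => A; near=> j; rewrite -ltnS (leq_trans _ (leqSpred _))//.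
  by near: j; move/cvgnyPgt : n1_infty; apply.
have c0 : 0 <= 2 `^ alpha^-1 :> R by exact: powR_ge0.
have p0 : 0 < m%:R - alpha by rewrite subr_gt0.
have mm : (1 <= m <= m)%N by rewrite m0 leqnn.
have upper := cvg_power_sum_times c0 alpha_lt_m (n_infty m mm) n1_infty (ratio m mm).
have lower := cvg_power_sum_times (addr_ge0 ler01 c0) alpha_lt_m pred_infty n1_infty ratio_pred.
(* The inverse of the common limit of both bounds, so that each rescaled bound tends to 1. *)
pose norm_const := (m%:R - alpha) / m%:R : R.
have norm_constK : norm_const * (m%:R / (m%:R - alpha)) = 1.
  by rewrite /norm_const; field; rewrite gt_eqF// pnatr_eq0 -lt0n m0.
have scale (f : nat -> R) :
    (fun j => f j / (n j 1%N)%:R `^ (m%:R - alpha)) @ \oo --> m%:R / (m%:R - alpha) ->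
    (fun j => norm_const * (f j / (n j 1%N)%:R `^ (m%:R - alpha))) @ \oo --> (1 : R).
  move=> f_lim; rewrite -[X in _ --> X]norm_constK.
  by apply: cvgM; [exact: cvg_cst|exact: f_lim].
rewrite /asymp_equiv.
apply: (squeeze_cvgr _ (scale _ lower) (scale _ upper)).
near=> j.
have n1 : (0 < n j 1%N)%N by near: j; move/cvgnyPgt : n1_infty; apply.
have pow0 : 0 < (n j 1%N)%:R `^ (m%:R - alpha) :> R by rewrite powR_gt0// ltr0n.
have /andP[lo hi] := autocorrelation_bounds alpha_gt0 m0 n1 (n_sorted j).
set P := _ `^ (_ - _) in pow0 *.
have mR : (0 : R) < m%:R by rewrite ltr0n.
have -> : autocorrelation alpha m (n j) / (2 * m%:R / (m%:R - alpha) * P) =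
    norm_const * ((autocorrelation alpha m (n j) / 2) / P).
  by rewrite /norm_const; field; rewrite !gt_eqF.
have nc0 : 0 < norm_const by rewrite divr_gt0.
rewrite !ler_pM2l// !ler_pM2r ?invr_gt0//.
by rewrite ler_pdivlMr// ler_pdivrMr// ![_ * 2]mulrC lo hi.
Unshelve. all: by end_near. Qed.
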